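(* Let $(M,\tilde\varphi,\xi,\eta,\tilde g)$ be a paracontact metric $(\tilde\kappa,\tilde\mu)$-manifold with $\tilde\kappa>-1$; assume the index of $\mathcal D_{\tilde h}(\pm\sqrt{1+\tilde\kappa})$ is constant on $M$. Then its curvature tensor is given, for all vector fields $X,Y,Z,W$, by $$\begin{aligned}\tilde g(\tilde R_{XY}Z,W)=&\Bigl(-1+\tfrac{\tilde\mu}{2}\Bigr)\bigl(\tilde g(Y,Z)\tilde g(X,W)-\tilde g(X,Z)\tilde g(Y,W)\bigr)\\&+\tilde g(Y,Z)\tilde g(\tilde hX,W)-\tilde g(X,Z)\tilde g(\tilde hY,W)-\tilde g(Y,W)\tilde g(\tilde hX,Z)+\tilde g(X,W)\tilde g(\tilde hY,Z)\\&+\frac{-1+\frac{\tilde\mu}{2}}{\tilde\kappa+1}\bigl(\tilde g(\tilde hY,Z)\tilde g(\tilde hX,W)-\tilde g(\tilde hX,Z)\tilde g(\tilde hY,W)\bigr)\\&-\frac{\tilde\mu}{2}\bigl(\tilde g(\tilde\varphi Y,Z)\tilde g(\tilde\varphi X,W)-\tilde g(\tilde\varphi X,Z)\tilde g(\tilde\varphi Y,W)\bigr)\\&+\frac{-\tilde\kappa-\frac{\tilde\mu}{2}}{\tilde\kappa+1}\bigl(\tilde g(\tilde\varphi\tilde hY,Z)\tilde g(\tilde\varphi\tilde hX,W)-\tilde g(\tilde\varphi\tilde hY,W)\tilde g(\tilde\varphi\tilde hX,Z)\bigr)\\&+\tilde\mu\,\tilde g(\tilde\varphi X,Y)\tilde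 g(\tilde\varphi Z,W)\\&+\eta(X)\eta(W)\bigl((\tilde\kappa+1-\tfrac{\tilde\mu}{2})\tilde g(Y,Z)+(\tilde\mu-1)\tilde g(\tilde hY,Z)\bigr)\\&-\eta(X)\eta(Z)\bigl((\tilde\kappa+1-\tfrac{\tilde\mu}{2})\tilde g(Y,W)+(\tilde\mu-1)\tilde g(\tilde hY,W)\bigr)\\&+\eta(Y)\eta(Z)\bigl((\tilde\kappa+1-\tfrac{\tilde\mu}{2})\tilde g(X,W)+(\tilde\mu-1)\tilde g(\tilde hX,W)\bigr)\\&-\eta(Y)\eta(W)\bigl((\tilde\kappa+1-\tfrac{\tilde\mu}{2})\tilde g(X,Z)+(\tilde\mu-1)\tilde g(\tilde hX,Z)\bigr).\end{aligned}$$
   Context: Conventions: $2d\eta(X,Y)=X(\eta(Y))-Y(\eta(X))-\eta([X,Y])$; $\tilde R_{XY}Z=\tilde\nabla_X\tilde\nabla_YZ-\tilde\nabla_Y\tilde\nabla_XZ-\tilde\nabla_{[X,Y]}Z$ with $\tilde\nabla$ the Levi-Civita connection of $\tilde g$. An almost paracontact structure on a $(2n+1)$-dimensional manifold $M$ is $(\tilde\varphi,\xi,\eta)$, with $\tilde\varphi$ a $(1,1)$-tensor field, $\xi$ a vector field, $\eta$ a 1-form, such that $\eta(\xi)=1$, $\tilde\varphi^2=I-\eta\otimes\xi$ and the $\pm1$-eigendistributions of $\tilde\varphi$ on $\mathcal D=\ker\eta$ both have dimension $n$. With a pseudo-Riemannian metric $\tilde g$ satisfying $\tilde g(\tilde\varphi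 X,\tilde\varphi Y)=-\tilde g(X,Y)+\eta(X)\eta(Y)$ and $d\eta(X,Y)=\tilde g(X,\tilde\varphi Y)$ it is a paracontact metric structure. Put $\tilde h=\frac12\mathcal L_\xi\tilde\varphi$. A paracontact metric $(\tilde\kappa,\tilde\mu)$-manifold ($\tilde\kappa,\tilde\mu$ real constants) is a paracontact metric manifold whose curvature tensor satisfies $\tilde R_{XY}\xi=\tilde\kappa(\eta(Y)X-\eta(X)Y)+\tilde\mu(\eta(Y)\tilde hX-\eta(X)\tilde hY)$ for all vector fields $X,Y$. When $\tilde\kappa>-1$, $\tilde h$ is diagonalizable with eigenvalues $0$ and $\pm\sqrt{1+\tilde\kappa}$ (the latter of multiplicity $n$ each); $\mathcal D_{\tilde h}(\pm\sqrt{1+\tilde\kappa})$ are the corresponding eigendistributions, and the index is that of the restriction of $\tilde g$. *)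

(* Defs.v *)
From HB Require Import structures.
From mathcomp Require Import all_boot all_order all_algebra.
From mathcomp Require Import all_classical all_reals all_analysis.
From mathcomp Require Import ring.
Set Implicit Arguments.
Unset Strict Implicit.
Unset Printing Implicit Defensive.
Import Order.TTheory GRing.Theory Num.Theory.
Import numFieldNormedType.Exports.
Local Open Scope classical_set_scope.
Local Open Scope ring_scope.

(* All partial derivatives of f up to order k exist and are continuous on the
   open set U.  The space is R^(d+1): 'rV_m is normed only for m > 0. *)
Fixpoint Ck (R : realType) (d k : nat) (U : set 'rV[R]_d.+1)
    (f : 'rV[R]_d.+1 -> R) : Prop :=
  (forall x, U x -> {for x, continuous f}) /\
  match k with
  | 0 => True
  | j.+1 => forall i : 'I_d.+1,
      (forall x, U x -> derivable f x (delta_mx 0 i)) /\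
      Ck j U ('D_(delta_mx 0 i) f)
  end.

Definition Cinfty (R : realType) (d : nat) (U : set 'rV[R]_d.+1)
    (f : 'rV[R]_d.+1 -> R) : Prop := forall k, Ck k U f.

Section Cinfty_closure.
Context {R : realType} {d : nat}.
Implicit Types (U : set 'rV[R]_d.+1) (f g : 'rV[R]_d.+1 -> R).

Lemma Ck_eq k U f g : open U -> (forall x, U x -> f x = g x) ->
  Ck k U f -> Ck k U g.
Proof.
move=> oU.
have near_eq (u v : 'rV[R]_d.+1 -> R) x : (forall x, U x -> u x = v x) -> U x ->
    \forall y \near x, u y = v y :> R.
  by move=> uv Ux; near=> y; apply: uv; near: y; exact: open_nbhs_nbhs.
have cont_eq (u v : 'rV[R]_d.+1 -> R) : (forall x, U x -> u x = v x) ->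
    (forall x, U x -> {for x, continuous u}) ->
    forall x, U x -> {for x, continuous v}.
  move=> uv cu x Ux; rewrite /prop_for /continuous_at -(uv x Ux).
  exact: cvg_trans (near_eq_cvg (near_eq u v x uv Ux)) (cu x Ux).
elim: k f g => [|k IH] f g fg [cf df]; split=> //; try exact: cont_eq fg cf.
move=> i; have [dfi ki] := df i; split.
  by move=> x Ux; apply: near_eq_derivable (dfi x Ux); exact: (near_eq f g).
by apply: IH ki => x Ux; apply: near_eq_derive; exact: (near_eq f g).
Unshelve. all: by end_near. Qed.

Lemma CkW k U f : Ck k.+1 U f -> Ck k U f.
Proof.
elim: k f => [|k IH] f [cf df]; first by split.
by split=> // i; have [dfi ki] := df i; split=> //; apply: IH.
Qed.

Lemma Ck_cst k U (c : R) : open U -> Ck k U (cst c).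
Proof.
move=> oU; elim: k c => [|k IH] c; (split=> //;
  first by move=> x _; exact: (@cst_continuous 'rV[R]_d.+1 R c)).
move=> i; split; first by move=> x _; exact: derivable_cst.
by apply: (Ck_eq oU _ (IH 0)) => x _; rewrite derive_cst.
Qed.

Lemma CkD k U f g : open U -> Ck k U f -> Ck k U g -> Ck k U (f \+ g).
Proof.
move=> oU; elim: k f g => [|k IH] f g [cf df] [cg dg]; split=> //.
- by move=> x Ux; apply: continuousD; [exact: cf|exact: cg].
- by move=> x Ux; apply: continuousD; [exact: cf|exact: cg].
move=> i; have [dfi kf] := df i; have [dgi kg] := dg i; split.
  by move=> x Ux; apply: derivableD; [exact: dfi|exact: dgi].
apply: Ck_eq (IH _ _ kf kg) => // x Ux.
by rewrite (deriveD (dfi x Ux) (dgi x Ux)).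
Qed.

Lemma CkM k U f g : open U -> Ck k U f -> Ck k U g -> Ck k U (f \* g).
Proof.
move=> oU; elim: k f g => [|k IH] f g Cf Cg; split=> //.
- by move=> x Ux; apply: continuousM; [exact: Cf.1|exact: Cg.1].
- by move=> x Ux; apply: continuousM; [exact: Cf.1|exact: Cg.1].
move=> i; have [dfi kf] := Cf.2 i; have [dgi kg] := Cg.2 i; split.
  by move=> x Ux; apply: derivableM; [exact: dfi|exact: dgi].
apply: Ck_eq (CkD oU (IH _ _ (CkW Cf) kg) (IH _ _ (CkW Cg) kf)) => // x Ux.
by rewrite (deriveM (dfi x Ux) (dgi x Ux)).
Qed.

End Cinfty_closure.

Record chart (R : realType) (d : nat) (T : topologicalType) := Chart {
  chart_dom : set T;
  chart_img : set 'rV[R]_d.+1;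
  chart_map :> T -> 'rV[R]_d.+1;
  chart_inv : 'rV[R]_d.+1 -> T;
  chart_dom_open : open chart_dom;
  chart_img_open : open chart_img;
  chart_mapS : forall p, chart_dom p -> chart_img (chart_map p);
  chart_invS : forall x, chart_img x -> chart_dom (chart_inv x);
  chart_mapK : forall p, chart_dom p -> chart_inv (chart_map p) = p;
  chart_invK : forall x, chart_img x -> chart_map (chart_inv x) = x;
  chart_map_cont : {within chart_dom, continuous chart_map};
  chart_inv_cont : {within chart_img, continuous chart_inv} }.

(* a \o b^-1 is C^oo on b (dom a `&` dom b) *)
Definition smooth_transition (R : realType) (d : nat) (T : topologicalType)
    (a b : chart R d T) : Prop :=
  forall j : 'I_d.+1,
    Cinfty (chart_img b `&` chart_inv b @^-1` chart_dom a)
      (fun x => a (chart_inv b x) 0 j).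

(* Smooth manifolds of dimension d + 1 *)
Record smoothManifold (R : realType) (d : nat) := SmoothManifold {
  carrier :> topologicalType;
  man_hausdorff : hausdorff_space carrier;
  man_second_countable : @second_countable carrier;
  atlas : set (chart R d carrier);
  atlas_cover : forall p : carrier, exists2 a, atlas a & chart_dom a p;
  atlas_compat : forall a b, atlas a -> atlas b -> smooth_transition a b }.

Section SmoothFunctions.
Context {R : realType} {d : nat} (M : smoothManifold R d).

Definition smooth (f : M -> R) : Prop :=
  forall a, atlas a -> Cinfty (chart_img a) (f \o chart_inv a).

Definition smooth_pred : {pred M -> R} := fun f => `[< smooth f >].

Lemma smooth_cst (c : R) : smooth (cst c).
Proof. by move=> a _ k; apply: Ck_cst; exact: chart_img_open. Qed.

Lemma smooth_subring : GRing.subring_closed smooth_pred.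
Proof.
have smM f g : smooth f -> smooth g -> smooth (f \* g).
  by move=> sf sg a Aa k; apply: CkM;
    [exact: chart_img_open|exact: sf|exact: sg].
split.
- by apply/asboolP; exact: smooth_cst.
- move=> f g /asboolP sf /asboolP sg; apply/asboolP.
  have -> : f - g = f \+ (cst (-1) \* g).
    by apply/funext => x /=; rewrite mulN1r.
  have sNg := smM _ _ (smooth_cst (-1)) sg.
  by move=> a Aa k; apply: CkD; [exact: chart_img_open|exact: sf|exact: sNg].
- by move=> f g /asboolP sf /asboolP sg; apply/asboolP; exact: smM.
Qed.

HB.instance Definition _ :=
  GRing.isSubringClosed.Build (M -> R) smooth_pred smooth_subring.

Record smoothFun := SmoothFun {
  smooth_val :> M -> R;
  smooth_valP : smooth_val \in smooth_pred }.

HB.instance Definition _ := [isSub for smooth_val].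
HB.instance Definition _ := [Choice of smoothFun by <:].
HB.instance Definition _ := 
  GRing.SubChoice_isSubComPzRing.Build (M -> R) smooth_pred smoothFun
    smooth_subring.

End SmoothFunctions.

Notation "''C^oo' ( M )" := (smoothFun M) (at level 8, format "''C^oo' ( M )").

Definition smooth_const (R : realType) (d : nat) (M : smoothManifold R d)
    (c : R) : 'C^oo(M) := SmoothFun (asboolT (smooth_cst (M := M) c)).

Notation "c %:S" := (smooth_const _ c) (at level 2,
  format "c %:S").

(* The tangent space at p: derivations at p of the algebra of smooth functions *)
Section TangentSpace.
Context {R : realType} {d : nat} (M : smoothManifold R d) (p : M).

Definition derivation_at (v : 'C^oo(M) -> R^o) : Prop :=
  [/\ forall f g, v (f + g) = v f + v g,
      forall (c : R) f, v (c%:S * f) = c * v f &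
      forall f g, v (f * g) = f p * v g + g p * v f].

Definition derivation_at_pred : {pred 'C^oo(M) -> R^o} :=
  fun v => `[< derivation_at v >].

Lemma derivation_at_submod : GRing.submod_closed derivation_at_pred.
Proof.
split=> [|k u v /asboolP[uD uZ uM] /asboolP[vD vZ vM]]; apply/asboolP; split.
- by move=> f g; rewrite addr0.
- by move=> c f; rewrite mulr0.
- by move=> f g; rewrite !mulr0 addr0.
- by move=> f g; rewrite !fctE uD vD scalerDr addrACA.
- by move=> c f; rewrite !fctE uZ vZ mulrDr; congr (_ + _); exact: mulrCA.
- move=> f g; rewrite !fctE uM vM !mulrDr !scalerDr addrACA.
  by congr (_ + _ + (_ + _)); exact: mulrCA.
Qed.

HB.instance Definition _ := GRing.isSubmodClosed.Build R
  ('C^oo(M) -> R^o) derivation_at_pred derivation_at_submod.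

Record tangent := Tangent {
  tangent_val :> 'C^oo(M) -> R^o;
  tangent_valP : tangent_val \in derivation_at_pred }.

HB.instance Definition _ := [isSub for tangent_val].
HB.instance Definition _ := [Choice of tangent by <:].
HB.instance Definition _ := [SubChoice_isSubLmodule of tangent by <:].

End TangentSpace.

Lemma commutator_leibniz (A : comPzRingType) (f g a b c e x y z w : A) :
  f * b + w * x + (g * a + z * y) - (f * e + y * z + (g * c + x * w)) =
  f * (b - e) + g * (a - c).
Proof. by ring. Qed.

(* Vector fields: derivations of the algebra of smooth functions *)
Section VectorFields.
Context {R : realType} {d : nat} (M : smoothManifold R d).

Definition derivation (X : 'C^oo(M) -> 'C^oo(M)^o) : Prop :=
  [/\ forall f g, X (f + g) = X f + X g,
      forall (c : R) f, X (c%:S * f) = c%:S * X f &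
      forall f g, X (f * g) = f * X g + g * X f].

Definition derivation_pred : {pred 'C^oo(M) -> 'C^oo(M)^o} :=
  fun X => `[< derivation X >].

Lemma derivation_submod : GRing.submod_closed derivation_pred.
Proof.
split=> [|k u v /asboolP[uD uZ uM] /asboolP[vD vZ vM]]; apply/asboolP; split.
- by move=> f g; rewrite addr0.
- by move=> c f; rewrite mulr0.
- by move=> f g; rewrite !mulr0 addr0.
- by move=> f g; rewrite !fctE uD vD scalerDr addrACA.
- by move=> c f; rewrite !fctE uZ vZ mulrDr; congr (_ + _); exact: mulrCA.
- move=> f g; rewrite !fctE uM vM !mulrDr !scalerDr addrACA.
  by congr (_ + _ + (_ + _)); exact: mulrCA.
Qed.

HB.instance Definition _ := GRing.isSubmodClosed.Build 'C^oo(M)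
  ('C^oo(M) -> 'C^oo(M)^o) derivation_pred derivation_submod.

Record vectorField := VectorField {
  vf_val :> 'C^oo(M) -> 'C^oo(M)^o;
  vf_valP : vf_val \in derivation_pred }.

HB.instance Definition _ := [isSub for vf_val].
HB.instance Definition _ := [Choice of vectorField by <:].
HB.instance Definition _ := [SubChoice_isSubLmodule of vectorField by <:].

Lemma bracket_derivation (X Y : vectorField) :
  (fun f => X (Y f) - Y (X f)) \in derivation_pred.
Proof.
have [XD XZ XM] := asboolP _ (vf_valP X).
have [YD YZ YM] := asboolP _ (vf_valP Y).
apply/asboolP; split.
- by move=> f g; rewrite YD XD XD YD opprD addrACA.
- by move=> c f; rewrite YZ XZ XZ YZ mulrBr.
- move=> f g; rewrite YM XM XD YD !XM !YM.
  exact: commutator_leibniz.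
Qed.

End VectorFields.

Notation "''X' ( M )" := (vectorField M) (at level 8, format "''X' ( M )").

Section Evaluation.
Context {R : realType} {d : nat} {M : smoothManifold R d}.

Lemma value_derivation (p : M) (X : 'X(M)) :
  (fun f => X f p) \in derivation_at_pred p.
Proof.
have [XD XZ XM] := asboolP _ (vf_valP X).
apply/asboolP; split.
- by move=> f g; rewrite XD.
- by move=> c f; rewrite XZ.
- by move=> f g; rewrite XM.
Qed.

Definition value (p : M) (X : 'X(M)) : tangent p :=
  Tangent (value_derivation p X).

Definition bracket (X Y : 'X(M)) : 'X(M) :=
  VectorField (bracket_derivation X Y).

End Evaluation.

Notation "[[ X , Y ]]" := (bracket X Y) (at level 0, format "[[ X ,  Y ]]").

(* Tensor fields are C^oo(M)-multilinear maps on vector fields.  Every tangent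
   vector at p is the value of a vector field, so pointwise notions are
   expressed through values of vector fields. *)
Section Tensors.
Context {R : realType} {d : nat} (M : smoothManifold R d).

(* Pointwise eigenspace at p of the (1,1)-tensor field F *)
Definition eigen_dist (F : 'X(M) -> 'X(M)) (lambda : R) (p : M) :
    set (tangent p) :=
  [set v | exists X, value p X = v /\ value p (F X) = lambda *: v].

Definition ker_dist (eta : {scalar 'X(M)}) (p : M) : set (tangent p) :=
  [set v | exists X, value p X = v /\ eta X p = 0].

Arguments eigen_dist F lambda p _ : clear implicits.
Arguments ker_dist eta p _ : clear implicits.

Definition has_dim (V : lmodType R) (D : set V) (k : nat) : Prop :=
  exists b : 'I_k -> V,
    [/\ forall i, D (b i),
        forall c : 'I_k -> R, \sum_i c i *: b i = 0 -> forall i, c i = 0 &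
        forall v, D v -> exists c : 'I_k -> R, v = \sum_i c i *: b i].

(* g is negative definite at p on some k-dimensional subspace of the subspace
   D of the tangent space; linear independence of the values of E at p follows
   from definiteness. *)
Definition neg_definite_dim (g : 'X(M) -> {scalar 'X(M)}) (p : M)
    (D : set (tangent p)) (k : nat) : Prop :=
  exists E : 'I_k -> 'X(M),
    (forall i, D (value p (E i))) /\
    forall c : 'I_k -> R, (exists i, c i != 0) ->
      \sum_i \sum_j c i * c j * g (E i) (E j) p < 0.

Definition has_index (g : 'X(M) -> {scalar 'X(M)}) (p : M)
    (D : set (tangent p)) (r : nat) : Prop :=
  neg_definite_dim g D r /\ forall k, neg_definite_dim g D k -> (k <= r)%N.

Definition constant_index (g : 'X(M) -> {scalar 'X(M)})
    (D : forall p : M, set (tangent p)) : Prop :=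
  exists r, forall p, has_index g (D p) r.

Record pseudoRiemannianMetric := PseudoRiemannianMetric {
  metric_form :> 'X(M) -> {scalar 'X(M)};
  metric_sym : forall X Y, metric_form X Y = metric_form Y X;
  metric_nondegenerate : forall (p : M) X,
    (forall Y, metric_form X Y p = 0) -> value p X = 0;
  metric_index : constant_index metric_form (fun p => setT) }.

Record is_connection (nabla : 'X(M) -> 'X(M) -> 'X(M)) : Prop := {
  connection_linear : forall f X X' Y,
    nabla (f *: X + X') Y = f *: nabla X Y + nabla X' Y;
  connection_additive : forall X Y Y',
    nabla X (Y + Y') = nabla X Y + nabla X Y';
  connection_leibniz : forall X f Y,
    nabla X (f *: Y) = (X f : 'C^oo(M)) *: Y + f *: nabla X Y }.

Record is_levi_civita (g : pseudoRiemannianMetric)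
    (nabla : 'X(M) -> 'X(M) -> 'X(M)) : Prop := {
  levi_civita_connection : is_connection nabla;
  levi_civita_torsion_free : forall X Y,
    nabla X Y - nabla Y X = [[X, Y]];
  levi_civita_metric : forall X Y Z : 'X(M),
    X (g Y Z) = g (nabla X Y) Z + g Y (nabla X Z) }.

Definition curvature (nabla : 'X(M) -> 'X(M) -> 'X(M)) (X Y Z : 'X(M)) :
    'X(M) :=
  nabla X (nabla Y Z) - nabla Y (nabla X Z) - nabla [[X, Y]] Z.

(* With the factor 1/2: 2 d eta(X,Y) = X(eta Y) - Y(eta X) - eta [X,Y] *)
Definition ext_deriv (eta : {scalar 'X(M)}) (X Y : 'X(M)) : 'C^oo(M) :=
  (2^-1)%:S * (X (eta Y) - Y (eta X) - eta [[X, Y]]).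

Definition lie_deriv (xi : 'X(M)) (phi : 'X(M) -> 'X(M)) (X : 'X(M)) : 'X(M) :=
  [[xi, phi X]] - phi [[xi, X]].

Definition htensor (phi : 'X(M) -> 'X(M)) (xi X : 'X(M)) : 'X(M) :=
  (2^-1)%:S *: lie_deriv xi phi X.

(* M is meant to have dimension 2n + 1. *)
Record is_almost_paracontact (n : nat) (phi : {linear 'X(M) -> 'X(M)})
    (xi : 'X(M)) (eta : {scalar 'X(M)}) : Prop := {
  paracontact_eta_xi : eta xi = 1;
  paracontact_phi2 : forall X, phi (phi X) = X - eta X *: xi;
  paracontact_plus : forall p,
    has_dim (eigen_dist phi 1 p `&` ker_dist eta p) n;
  paracontact_minus : forall p,
    has_dim (eigen_dist phi (-1) p `&` ker_dist eta p) n }.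

Record is_paracontact_metric (n : nat) (phi : {linear 'X(M) -> 'X(M)})
    (xi : 'X(M)) (eta : {scalar 'X(M)}) (g : pseudoRiemannianMetric) :
    Prop := {
  paracontact_almost : is_almost_paracontact n phi xi eta;
  paracontact_compat : forall X Y,
    g (phi X) (phi Y) = - g X Y + eta X * eta Y;
  paracontact_contact : forall X Y, ext_deriv eta X Y = g X (phi Y) }.

Definition kappa_mu_condition (phi : {linear 'X(M) -> 'X(M)}) (xi : 'X(M))
    (eta : {scalar 'X(M)}) (nabla : 'X(M) -> 'X(M) -> 'X(M)) (kappa mu : R) :
    Prop :=
  let h := htensor phi xi in
  forall X Y, curvature nabla X Y xi =
    kappa%:S *: (eta Y *: X - eta X *: Y) +
    mu%:S *: (eta Y *: h X - eta X *: h Y).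

End Tensors.

Arguments eigen_dist {R d M} F lambda p _.
Arguments ker_dist {R d M} eta p _.

(* Main.v *)
Require Import Defs.
From HB Require Import structures.
From mathcomp Require Import all_boot all_order all_algebra.
From mathcomp Require Import all_classical all_reals all_analysis.
From mathcomp Require Import ring.

(** The curvature of a paracontact metric (kappa, mu)-manifold is determined by
    linear algebra, and the proof needs only the module structure of vector
    fields over the ring of smooth functions, not eigenvectors or local frames.

    The contact condition and the compatibility of the metric give
    nabla_X xi = - phi X + phi h X, with h symmetric and anticommuting with phi
    (S_E, g_h_r, h_phi).  Inserting xi in the (kappa, mu)-condition gives
    h^2 = (kappa + 1) phi^2 and nabla_xi h = - mu phi h (h2, Dh_xi).

    Next the covariant derivatives of phi and h are computed completely
    (Dphi_formula, Dh_formula).  Their differences from the expected formulas,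
    the defects, satisfy homogeneous linear identities: the fundamental form is
    closed, phi^2, h^2 and the anticommutator of phi and h are known, and the
    (kappa, mu)-condition is a Codazzi equation relating the two.  As kappa + 1
    is invertible, so is h on the kernel of eta, and these identities force both
    defects to vanish.

    Differentiating once more, the Ricci identities express the commutators of
    the curvature operators with phi and h by known tensors (curv_phi, curv_h).
    The tensor of the asserted formula has the same commutators, the same values
    on xi and the symmetries of a curvature tensor.  The difference is therefore
    an algebraic curvature tensor which annihilates xi and commutes with h and
    phi, and such a tensor is zero (D_eq0). *)

Set Implicit Arguments.
Unset Strict Implicit.
Unset Printing Implicit Defensive.
Import Order.TTheory GRing.Theory Num.Theory.
Import numFieldNormedType.Exports.
Local Open Scope classical_set_scope.
Local Open Scope ring_scope.

Lemma eq_from (U : zmodType) (a b c d : U) : a = b -> c - d = a - b -> c = d.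
Proof. by move=> -> /eqP; rewrite subrr subr_eq0 => /eqP. Qed.
Lemma eq_add (U : zmodType) (a b c d : U) : a = b -> c = d -> a + c = b + d.
Proof. by move=> -> ->. Qed.
Lemma eq_sub (U : zmodType) (a b c d : U) : a = b -> c = d -> a - c = b - d.
Proof. by move=> -> ->. Qed.

Lemma unit_mulI (A : comPzRingType) (cinv c a b : A) :
  cinv * c = 1 -> c * a = c * b -> a = b.
Proof. by move=> e ab; rewrite -[a]mul1r -e -mulrA ab mulrA e mul1r. Qed.

Lemma double_inj (A : comPzRingType) (half a : A) :
  half + half = 1 -> a + a = 0 -> a = 0.
Proof. by move=> e aa0; rewrite -[a]mul1r -e mulrDl -mulrDr aa0 mulr0. Qed.

(** * Algebraic curvature tensors commuting with h and phi *)

(** In terms of the eigenspaces of [h], for [c] a nonzero square: [h]-invariance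
    makes [D] vanish as soon as a pair [X, Y] or [Z, W] mixes the two
    eigenspaces, Bianchi then kills the components of type [(+, +, -, -)], and
    [phi], which exchanges the eigenspaces, those of type [(+, +, +, +)].  The
    proof below is the eigenvalue-free version of this argument. *)
Section CurvatureLike.
Variables (A : comPzRingType) (T : Type) (D : T -> T -> T -> T -> A).
Variables (h phi : T -> T) (half c cinv : A).
Hypothesis half2 : half + half = 1.
Hypothesis cinvM : cinv * c = 1.
Hypothesis D_antisym : forall X Y Z W, D Y X Z W = - D X Y Z W.
Hypothesis D_skew : forall X Y Z W, D X Y W Z = - D X Y Z W.
Hypothesis D_bianchi : forall X Y Z W, D X Y Z W + D Y Z X W + D Z X Y W = 0.
Hypothesis D_h : forall X Y Z W, D X Y (h Z) W = D X Y Z (h W).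
Hypothesis D_phi : forall X Y Z W, D X Y (phi Z) W = - D X Y Z (phi W).
Hypothesis D_h_phi : forall X Y Z W,
  D X Y Z (h (phi W)) = - D X Y Z (phi (h W)).
Hypothesis D_h2 : forall X Y Z W, D X Y Z (h (h W)) = c * D X Y Z W.
Hypothesis D_phi2 : forall X Y Z W, D X Y Z (phi (phi W)) = D X Y Z W.

(** The usual octahedron argument: the alternating sum of the four Bianchi
    identities on [X, Y, Z, W] is twice the difference. *)
Lemma D_pair X Y Z W : D X Y Z W = D Z W X Y.
Proof.
apply/eqP; rewrite -subr_eq0; apply/eqP; apply: (double_inj half2).
have b1 := D_bianchi X Y Z W; have b2 := D_bianchi Y Z W X.
have b3 := D_bianchi Z W X Y; have b4 := D_bianchi W X Y Z.
rewrite -[RHS](subrr (0 + 0)) -{1}b1 -{1}b2 -{1}b3 -b4.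
rewrite (D_skew Y Z X W) (D_skew Z W X Y) (D_skew W Y X Z) (D_antisym Y W).
rewrite (D_skew W X Y Z) (D_antisym X W) (D_skew X Z Y W) (D_antisym Z X).
rewrite (D_skew X Y Z W) (D_skew Y W Z X).
by ring.
Qed.

Lemma D_h_left X Y Z W : D (h X) Y Z W = D X (h Y) Z W.
Proof. by rewrite !(D_pair _ _ Z) D_h. Qed.

Lemma D_h_h X Y Z W : D (h X) (h Y) Z W = c * D X Y Z W.
Proof. by rewrite D_h_left D_pair D_h2 -D_pair. Qed.

(** Write [b1], [b2], [b3] for the values [D (h X) Y (h Z) W] along the cyclic
    permutations of [X, Y, Z] and [d1], [d2], [d3] for those of [D].  The
    Bianchi identity on [h U, h V, Q] says [c * d1 + b2 + b3 = 0] and its cyclic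
    shifts; since the [di] sum to [0], so do the [bi], hence [b1 = c * d1]. *)
Lemma D_hXhZ X Y Z W : D (h X) Y (h Z) W = c * D X Y Z W.
Proof.
have key U V Q : c * D U V Q W + D (h V) Q (h U) W + D (h Q) U (h V) W = 0.
  by rewrite -D_h_h (D_h_left Q) D_bianchi.
apply/eqP; rewrite -subr_eq0; apply/eqP; apply: (double_inj half2).
rewrite -[RHS](subrr (0 + 0)) -{1}(key Y Z X) -{1}(key Z X Y) -{1}(key X Y Z).
by rewrite -(mulr0 c) -(D_bianchi X Y Z W); ring.
Qed.

Lemma D_h_swap X Y Z W : D (h X) Y Z W = D X Y (h Z) W.
Proof. by apply: (unit_mulI cinvM); rewrite -(D_hXhZ _ _ (h Z)) -D_h2 !D_h. Qed.

(** [h] may now be moved from any argument to any other without a sign, while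
    [phi], which anticommutes with [h], changes sign when it crosses from [Z] to
    [W]: moving both around shows that [D (h P) Q R (phi S)] is its own
    opposite. *)
Lemma D_eq0 X Y Z W : D X Y Z W = 0.
Proof.
have e P Q R S : D (h P) Q R (phi S) = 0.
  apply: (double_inj half2).
  by rewrite {1}D_h_swap D_h D_h_phi -D_phi -D_h -D_h_swap D_phi addNr.
by apply: (unit_mulI cinvM); rewrite -D_h_h -D_phi2 e mulr0.
Qed.
End CurvatureLike.

(** * Paracontact (k, m)-structures on a module with derivations *)

(** [A] stands for the ring of smooth functions, [V] for its module of vector
    fields, [act] for the action of vector fields on functions; [k] and [m] are
    the constants kappa and mu, [half] is one half and [kinv] the inverse of
    kappa + 1.  Tensor identities are pure algebra over these data. *)
Section Paracontact.
Variables (A : comPzRingType) (V : lmodType A).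
Variables (half kinv k m : A).
Variables (act : V -> A -> A) (br nabla : V -> V -> V) (g : V -> V -> A).
Variables (phi h : V -> V) (xi : V) (eta : V -> A).

Hypothesis half2 : half + half = 1.
Hypothesis kinvM : kinv * (1 + k) = 1.
Hypothesis act_const : forall X, act X k = 0 /\ act X m = 0.
Hypothesis actD : forall X a b, act X (a + b) = act X a + act X b.
Hypothesis actM : forall X a b, act X (a * b) = a * act X b + b * act X a.
Hypothesis act_br : forall X Y a,
  act (br X Y) a = act X (act Y a) - act Y (act X a).
Hypothesis jacobi : forall X Y Z,
  br X (br Y Z) + br Y (br Z X) + br Z (br X Y) = 0.

Hypothesis nablaDl : forall X X' Y, nabla (X + X') Y = nabla X Y + nabla X' Y.
Hypothesis nablaZl : forall a X Y, nabla (a *: X) Y = a *: nabla X Y.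
Hypothesis nablaD : forall X Y Y', nabla X (Y + Y') = nabla X Y + nabla X Y'.
Hypothesis nablaZ : forall X a Y,
  nabla X (a *: Y) = act X a *: Y + a *: nabla X Y.
Hypothesis torsion_free : forall X Y, nabla X Y - nabla Y X = br X Y.
Hypothesis nabla_g : forall X Y Z,
  act X (g Y Z) = g (nabla X Y) Z + g Y (nabla X Z).

Hypothesis gC : forall X Y, g X Y = g Y X.
Hypothesis gDr : forall X Y Z, g X (Y + Z) = g X Y + g X Z.
Hypothesis gZr : forall a X Y, g X (a *: Y) = a * g X Y.
Hypothesis g_nondeg : forall X, (forall Y, g X Y = 0) -> X = 0.

Hypothesis phiD : forall X Y, phi (X + Y) = phi X + phi Y.
Hypothesis phiZ : forall a X, phi (a *: X) = a *: phi X.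
Hypothesis etaD : forall X Y, eta (X + Y) = eta X + eta Y.
Hypothesis etaZ : forall a X, eta (a *: X) = a * eta X.
Hypothesis eta_xi : eta xi = 1.
Hypothesis phi2 : forall X, phi (phi X) = X - eta X *: xi.
Hypothesis g_phi_phi : forall X Y, g (phi X) (phi Y) = - g X Y + eta X * eta Y.
Hypothesis contact : forall X Y,
  half * (act X (eta Y) - act Y (eta X) - eta (br X Y)) = g X (phi Y).
Hypothesis h_def : forall X, h X = half *: (br xi (phi X) - phi (br xi X)).

(** Locked, as are the other tensors below: otherwise rewriting with the
    additivity of [g] would see through the definition. *)
Definition curv X Y Z :=
  locked (nabla X (nabla Y Z) - nabla Y (nabla X Z) - nabla (br X Y) Z).

Hypothesis kappa_mu : forall X Y, curv X Y xi =
  k *: (eta Y *: X - eta X *: Y) + m *: (eta Y *: h X - eta X *: h Y).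

Lemma gDl X Y Z : g (X + Y) Z = g X Z + g Y Z.
Proof. by rewrite gC gDr !(gC Z). Qed.
Lemma gZl a X Z : g (a *: X) Z = a * g X Z.
Proof. by rewrite gC gZr (gC Z). Qed.
Lemma gNl X Z : g (- X) Z = - g X Z.
Proof. by rewrite -scaleN1r gZl mulN1r. Qed.
Lemma gNr X Z : g X (- Z) = - g X Z.
Proof. by rewrite -scaleN1r gZr mulN1r. Qed.
Lemma g0l X : g 0 X = 0.
Proof. by rewrite -(scale0r 0) gZl mul0r. Qed.
Lemma g0r X : g X 0 = 0. Proof. by rewrite gC g0l. Qed.
Definition gE := (gDl, gDr, gNl, gNr, gZl, gZr, g0l, g0r).

Lemma g_inj X Y : (forall W, g X W = g Y W) -> X = Y.
Proof.
move=> e; apply/eqP; rewrite -subr_eq0; apply/eqP; apply: g_nondeg => W.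
by rewrite gDl gNl e subrr.
Qed.

Lemma phiN X : phi (- X) = - phi X.
Proof. by rewrite -scaleN1r phiZ scaleN1r. Qed.
Lemma phi0 : phi 0 = 0. Proof. by rewrite -(scale0r 0) phiZ !scale0r. Qed.
Lemma etaN X : eta (- X) = - eta X.
Proof. by rewrite -scaleN1r etaZ mulN1r. Qed.
Lemma eta0 : eta 0 = 0. Proof. by rewrite -(scale0r 0) etaZ mul0r. Qed.
Lemma act1 X : act X 1 = 0.
Proof.
have := actM X 1 1; rewrite !mulr1 !mul1r => /eqP.
by rewrite -subr_eq0 opprD addNKr oppr_eq0 => /eqP.
Qed.
Lemma act0 X : act X 0 = 0.
Proof. by have := actM X 0 0; rewrite !mul0r addr0. Qed.
Lemma actN X a : act X (- a) = - act X a.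
Proof. by apply/eqP; rewrite -addr_eq0 -actD addNr act0. Qed.
Lemma actk X : act X k = 0. Proof. by case: (act_const X). Qed.
Lemma actm X : act X m = 0. Proof. by case: (act_const X). Qed.
Lemma nablaNl X Y : nabla (- X) Y = - nabla X Y.
Proof. by rewrite -scaleN1r nablaZl scaleN1r. Qed.
Lemma nabla0 X : nabla X 0 = 0.
Proof. by rewrite -(scale0r 0) nablaZ act0 !scale0r !addr0. Qed.
Lemma nablaN X Y : nabla X (- Y) = - nabla X Y.
Proof. by apply/eqP; rewrite -addr_eq0 -nablaD addNr nabla0. Qed.
Lemma nabla0l Y : nabla 0 Y = 0.
Proof. by rewrite -(scale0r 0) nablaZl !scale0r. Qed.

(** ** The characteristic vector field *)

(** [phi xi = a *: xi] by [phi2]; the contact condition on [xi, xi] gives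
    [a * g xi xi = 0], so that compatibility yields first [g xi xi = 1], then
    [a = 0]. *)
Lemma phi_xi_g_xi_xi : phi xi = 0 /\ g xi xi = 1.
Proof.
have phi2xi : phi (phi xi) = 0 by rewrite phi2 eta_xi scale1r subrr.
have e : phi xi = eta (phi xi) *: xi.
  by apply/eqP; rewrite -subr_eq0 -phi2 phi2xi phi0.
have a0 : eta (phi xi) * g xi xi = 0.
  rewrite -gZr -e -contact -(torsion_free xi xi) !subrr eta0.
  by rewrite subrr mulr0.
have g1 : g xi xi = 1.
  have := g_phi_phi xi xi; rewrite eta_xi mulr1 e gZl gZr a0 mulr0.
  by move/eqP; rewrite eq_sym addrC subr_eq0 eq_sym => /eqP.
by split=> //; rewrite e -[eta _]mulr1 -g1 a0 scale0r.
Qed.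
Lemma phi_xi : phi xi = 0. Proof. by case: phi_xi_g_xi_xi. Qed.
Lemma g_xi_r X : g X xi = eta X.
Proof.
have := g_phi_phi X xi; rewrite phi_xi g0r eta_xi mulr1 addrC => /eqP.
by rewrite eq_sym subr_eq0 => /eqP.
Qed.
Lemma g_xi_l X : g xi X = eta X. Proof. by rewrite gC g_xi_r. Qed.
Lemma phi3 X : phi (phi (phi X)) = phi X.
Proof. by rewrite [phi (phi X)]phi2 phiD phiN phiZ phi_xi scaler0 subr0. Qed.
Lemma eta_phi X : eta (phi X) = 0.
Proof.
have := phi2 (phi X); rewrite phi3 => /eqP.
rewrite -subr_eq0 opprB addrC addrNK => /eqP e.
by rewrite -[eta _]mulr1 -eta_xi -etaZ e eta0.
Qed.
Lemma g_phi_r X Y : g X (phi Y) = - g (phi X) Y.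
Proof.
have := g_phi_phi X (phi Y).
by rewrite phi2 gDr gNr gZr g_xi_r !eta_phi !mulr0 subr0 addr0 => ->;
  rewrite opprK.
Qed.

Local Notation S X := (nabla X xi).

Lemma act_eta X Y : act X (eta Y) = eta (nabla X Y) + g (S X) Y.
Proof. by rewrite -!g_xi_r nabla_g (gC Y). Qed.

(** The exterior derivative of [eta] is the skew part of its covariant
    derivative. *)
Lemma S_skew X Y : g (S X) Y - g (S Y) X = g X (phi Y) + g X (phi Y).
Proof.
rewrite -contact -mulrDl half2 mul1r -torsion_free !act_eta etaD etaN.
by ring.
Qed.
Lemma eta_S X : eta (S X) = 0.
Proof.
apply: (double_inj half2); have := act_eta X xi.
by rewrite eta_xi act1 g_xi_r => <-.
Qed.
Lemma S_xi : S xi = 0.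
Proof.
apply: g_nondeg => Y; have := S_skew xi Y.
by rewrite g_xi_r eta_S subr0 g_xi_l eta_phi addr0.
Qed.

(** ** Symmetries of the curvature *)

Lemma curvE X Y Z : curv X Y Z =
  nabla X (nabla Y Z) - nabla Y (nabla X Z) - nabla (br X Y) Z.
Proof. by rewrite /curv -lock. Qed.

(** With [eq_from], [eq_add] and [eq_sub], this reduces the deduction of an
    identity from a linear combination of known ones to a ring computation. *)
Lemma veq_from (u v x y : V) :
  x = y -> (forall W, g u W - g v W = g x W - g y W) -> u = v.
Proof. by move=> e f; apply: g_inj => W; apply: eq_from (f W); rewrite e. Qed.

Lemma curv_antisym X Y Z : curv Y X Z = - curv X Y Z.
Proof.
rewrite !curvE -!torsion_free !nablaDl !nablaNl !opprD !opprK.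
by apply: g_inj => W; rewrite !gE; ring.
Qed.

Lemma g_curv_skew X Y Z W : g (curv X Y Z) W = - g (curv X Y W) Z.
Proof.
apply: eq_from (esym (act_br X Y (g Z W))) _.
rewrite !curvE !(nabla_g, actD) !gE.
by rewrite !(gC _ Z); ring.
Qed.

Lemma bianchi X Y Z : curv X Y Z + curv Y Z X + curv Z X Y = 0.
Proof.
have e : curv X Y Z + curv Y Z X + curv Z X Y =
    br X (br Y Z) + br Y (br Z X) + br Z (br X Y).
  apply: g_inj => W.
  by rewrite !curvE -!torsion_free !(nablaD, nablaN, nablaDl, nablaNl) !gE;
    ring.
by rewrite e jacobi.
Qed.

(** ** The covariant derivatives of phi and h *)

Definition Dphi X Y := locked (nabla X (phi Y) - phi (nabla X Y)).
Lemma DphiE X Y : Dphi X Y = nabla X (phi Y) - phi (nabla X Y).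
Proof. by rewrite /Dphi -lock. Qed.
Definition Dh X Y := locked (nabla X (h Y) - h (nabla X Y)).
Lemma DhE X Y : Dh X Y = nabla X (h Y) - h (nabla X Y).
Proof. by rewrite /Dh -lock. Qed.

Lemma nabla_phi X Y : nabla X (phi Y) = phi (nabla X Y) + Dphi X Y.
Proof. by rewrite DphiE addrC subrK. Qed.
Lemma nabla_h X Y : nabla X (h Y) = h (nabla X Y) + Dh X Y.
Proof. by rewrite DhE addrC subrK. Qed.

Lemma g_Dphi_skew X Y Z : g (Dphi X Y) Z = - g (Dphi X Z) Y.
Proof.
have e : act X (g (phi Y) Z) = - act X (g (phi Z) Y).
  by rewrite -actN (gC _ Y) g_phi_r opprK.
apply: eq_from e _.
rewrite !DphiE !nabla_g !gE (gC _ (nabla X Z)) (gC _ (nabla X Y)) !g_phi_r.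
by ring.
Qed.

(** The fundamental form [g X (phi Y)] is the exterior derivative of [eta],
    hence closed.  Concretely, differentiating [S_skew] expresses its covariant
    derivative by second derivatives of [xi], whose cyclic sum is the Bianchi
    identity paired with [xi]. *)
Lemma Dphi_closed X Y Z :
  g (Dphi X Y) Z + g (Dphi Y Z) X + g (Dphi Z X) Y = 0.
Proof.
have key U W T : g (Dphi U W) T + g (Dphi U W) T =
    g (nabla U (S T)) W - g (nabla U (S W)) T - g (S (nabla U T)) W +
    g (S (nabla U W)) T.
  have e := congr1 (act U) (S_skew T W).
  have := eq_sub (eq_sub e (S_skew (nabla U T) W)) (S_skew T (nabla U W)).
  move/esym/eq_from; apply; rewrite !actD actN !nabla_g nabla_phi !gE.
  by rewrite !(gC T); ring.
apply: (double_inj half2).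
have := congr1 (g^~ xi) (bianchi X Y Z); rewrite /= !gE.
rewrite !(g_curv_skew _ _ _ xi) => e.
have := eq_add (eq_add (eq_add (key X Y Z) (key Y Z X)) (key Z X Y)) e.
move/eq_from; apply; rewrite !curvE -!torsion_free.
by rewrite !(nablaDl, nablaNl) !gE; ring.
Qed.

(** ** The tensor h and the derivative of xi *)

(** [Dphi_closed] on [xi, Y, Z]; equivalently, [xi] preserves the fundamental
    form. *)
Lemma Dphi_xi_S Y : Dphi xi Y =
  - S (phi Y) - phi (S Y) - phi (phi Y) - phi (phi Y).
Proof.
apply: g_inj => Z.
have e := Dphi_closed xi Y Z; have c := S_skew Z (phi Y).
have nx U : Dphi U xi = - phi (S U) by rewrite DphiE phi_xi nabla0 sub0r.
have := eq_sub e c; move/eq_from; apply.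
rewrite nx (g_Dphi_skew Y Z) nx !gE (g_phi_r (S Z) Y) !(gC Z).
by ring.
Qed.

Lemma h_S X : h X = - S (phi X) - phi (phi X).
Proof.
rewrite h_def -!torsion_free phiD phiN.
have -> : nabla xi (phi X) - S (phi X) - (phi (nabla xi X) - phi (S X)) =
    Dphi xi X - S (phi X) + phi (S X).
  by rewrite nabla_phi; apply: g_inj => W; rewrite !gE; ring.
rewrite Dphi_xi_S; set u := - S _; set v := phi (S X); set w := phi (phi X).
have -> : u - v - w - w + u + v = (u - w) + (u - w).
  by apply: g_inj => W; rewrite !gE; ring.
by rewrite scalerDr -scalerDl half2 scale1r.
Qed.

(** Apply [h_S] to [phi X], using that [phi] cubed is [phi]. *)
Lemma S_h_phi X : S X = - phi X - h (phi X).
Proof.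
rewrite h_S phi3 phi2 nablaDl nablaNl nablaZl S_xi scaler0 subr0.
by rewrite opprD !opprK addrCA addNr addr0.
Qed.

Lemma Dphi_phi X Y :
  Dphi X (phi Y) + phi (Dphi X Y) = - (g (S X) Y *: xi) - eta Y *: S X.
Proof.
rewrite !DphiE phi2 phiD phiN phi2 nablaD nablaN nablaZ act_eta.
by apply: g_inj => W; rewrite !gE; ring.
Qed.

Lemma double_injV (u : V) : u + u = 0 -> u = 0.
Proof.
by move=> e; rewrite -[u]scale1r -half2 scalerDl -scalerDr e scaler0.
Qed.

Lemma S_phi2 X : S (phi (phi X)) = S X.
Proof. by rewrite phi2 nablaDl nablaNl nablaZl S_xi scaler0 subr0. Qed.
Lemma phi2_S X : phi (phi (S X)) = S X.
Proof. by rewrite phi2 eta_S scale0r subr0. Qed.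

(** Differentiate [phi2] along [xi]. *)
Lemma phi_S_phi Y : phi (S (phi Y)) = - S Y - phi Y - phi Y.
Proof.
have := Dphi_phi xi Y; rewrite S_xi g0l scaler0 scale0r subr0 oppr0.
rewrite !Dphi_xi_S !(phiD, phiN) !phi3 S_phi2 phi2_S => e.
apply/eqP; rewrite -subr_eq0 -oppr_eq0; apply/eqP/double_injV.
by rewrite -[RHS]e; apply: g_inj => W; rewrite !gE; ring.
Qed.

Lemma h_phi Y : h (phi Y) = - phi (h Y).
Proof.
rewrite !h_S !(phiD, phiN) !phi3 S_phi2 phi_S_phi.
by apply: g_inj => W; rewrite !gE; ring.
Qed.

Lemma hD X Y : h (X + Y) = h X + h Y.
Proof.
by rewrite !h_S !phiD nablaDl; apply: g_inj => W; rewrite !gE; ring.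
Qed.
Lemma hZ a X : h (a *: X) = a *: h X.
Proof.
by rewrite !h_S !phiZ nablaZl; apply: g_inj => W; rewrite !gE; ring.
Qed.
Lemma hN X : h (- X) = - h X.
Proof. by rewrite -scaleN1r hZ scaleN1r. Qed.
Lemma h_xi : h xi = 0.
Proof. by rewrite h_S phi_xi phi0 nabla0l subr0 oppr0. Qed.
Lemma eta_h X : eta (h X) = 0.
Proof. by rewrite h_S etaD !etaN eta_S eta_phi subr0 oppr0. Qed.

Lemma S_E X : S X = - phi X + phi (h X).
Proof. by rewrite S_h_phi h_phi opprK. Qed.

Lemma h_phi_S X : h X = phi (S X) + phi (phi X).
Proof.
rewrite S_E phiD phiN (phi2 (h X)) eta_h scale0r subr0.
by rewrite addrAC addNr add0r.
Qed.

Lemma g_h_r X Y : g X (h Y) = g (h X) Y.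
Proof.
have c := S_skew (phi X) Y; apply: eq_from c _.
rewrite (h_phi_S Y) (h_S X) !gE (gC (S Y)) !g_phi_r.
by ring.
Qed.

Lemma Dphi_xi Y : Dphi xi Y = 0.
Proof.
rewrite Dphi_xi_S !S_E !(phiD, phiN) h_phi phiN.
by apply: g_inj => W; rewrite !gE; ring.
Qed.

(** ** The curvature in the direction of xi *)

Lemma nabla_S X Y : nabla X (S Y) = S (nabla X Y) - Dphi X Y + Dphi X (h Y)
  + phi (Dh X Y).
Proof.
rewrite !S_E nablaD nablaN !(nabla_phi, nabla_h, phiD).
by apply: g_inj => W; rewrite !gE; ring.
Qed.

Lemma curv_xi X Y : curv X Y xi =
  - Dphi X Y + Dphi X (h Y) + phi (Dh X Y)
  - (- Dphi Y X + Dphi Y (h X) + phi (Dh Y X)).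
Proof.
rewrite curvE !nabla_S -torsion_free nablaDl nablaNl.
by apply: g_inj => W; rewrite !gE; ring.
Qed.

Lemma Dh_phi X Y :
  Dh X (phi Y) + h (Dphi X Y) + Dphi X (h Y) + phi (Dh X Y) = 0.
Proof.
rewrite DhE (DphiE _ (h _)) h_phi nablaN !nabla_phi hD h_phi.
by rewrite nabla_h phiD; apply: g_inj => W; rewrite !gE; ring.
Qed.

Lemma Dh_xi_r X : Dh X xi = - h (S X).
Proof. by rewrite DhE h_xi nabla0 sub0r. Qed.
Lemma Dphi_xi_r X : Dphi X xi = - phi (S X).
Proof. by rewrite DphiE phi_xi nabla0 sub0r. Qed.

Lemma g_Dh_sym X Y Z : g (Dh X Y) Z = g (Dh X Z) Y.
Proof.
have := congr1 (act X) (g_h_r Y Z); move/esym/eq_from; apply.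
rewrite !nabla_g !DhE !gE g_h_r -(g_h_r (nabla X Z)) !(gC Y).
by rewrite (gC (nabla X Z)); ring.
Qed.

(** Evaluate the (k, m)-condition on [xi, Y].  Of the resulting terms [h (h Y)]
    and [phi (phi Y)] commute with [phi], while [h Y] and [phi (Dh xi Y)]
    anticommute with it, so the equation splits into the two assertions. *)
Lemma h2_and_Dh_xi X :
  h (h X) = (1 + k) *: phi (phi X) /\ Dh xi X = - (m *: phi (h X)).
Proof.
have phi_Dh Y : phi (Dh xi Y) = h (h Y) - (1 + k) *: phi (phi Y) - m *: h Y.
  have := kappa_mu xi Y; rewrite curv_xi !Dphi_xi Dphi_xi_r Dh_xi_r h_xi.
  rewrite (DphiE Y 0) phi0 nabla0 phi0 subrr eta_xi !S_E.
  rewrite !(hD, hN, phiD, phiN, h_phi) => e; apply: veq_from e _ => W.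
  by rewrite ?(phi2 (h _)) !phi2 ?eta_h ?eta_phi !gE; ring.
have Dh_phi_xi Y : Dh xi (phi Y) = - phi (Dh xi Y).
  have := Dh_phi xi Y; rewrite !Dphi_xi -(scale0r 0) hZ !scale0r !addr0 => e.
  by apply/eqP; rewrite -addr_eq0 e.
have h2phi Y : phi (h (h Y)) = (1 + k) *: phi Y.
  apply/eqP; rewrite -subr_eq0; apply/eqP/double_injV.
  have := Dh_phi_xi Y => /(congr1 phi); rewrite phi_Dh phiN phi_Dh.
  rewrite !(h_phi, phiN, phiD, phiZ, hN) !phi3 => e; apply: veq_from e _ => W.
  by rewrite !gE; ring.
have h2 Y : h (h Y) = (1 + k) *: phi (phi Y).
  by have := congr1 phi (h2phi Y);
    rewrite phiZ (phi2 (h _)) eta_h scale0r subr0.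
split=> //; have := congr1 phi (phi_Dh X);
  rewrite h2 subrr sub0r phiN phiZ => <-.
rewrite phi2 -g_xi_r g_Dh_sym Dh_xi_r S_xi -(scale0r 0) hZ scale0r oppr0 g0l.
by rewrite scale0r subr0.
Qed.
Lemma h2 X : h (h X) = (1 + k) *: phi (phi X).
Proof. by case: (h2_and_Dh_xi X). Qed.
Lemma Dh_xi X : Dh xi X = - (m *: phi (h X)).
Proof. by case: (h2_and_Dh_xi X). Qed.

Lemma g_phiC X Y : g (phi X) Y = - g (phi Y) X.
Proof. by rewrite -(g_phi_r Y) gC. Qed.
Lemma g_hC X Y : g (h X) Y = g (h Y) X.
Proof. by rewrite -(g_h_r Y) gC. Qed.
Lemma g_phihC X Y : g (phi (h X)) Y = g (phi (h Y)) X.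
Proof. by rewrite g_phiC g_h_r h_phi gNl opprK. Qed.

Lemma h0 : h 0 = 0. Proof. by rewrite -(scale0r 0) hZ !scale0r. Qed.

(** Reduces a pairing of words in [phi] and [h] to a polynomial in
    [g X W], [g (h X) W], [g (phi X) W], [g (phi (h X)) W] and [eta]. *)
Definition tensorE := (phi2, h2, h_phi, (phiD, phiN, phiZ), (hD, hN, hZ),
  (etaD, etaN, etaZ), (phi_xi, h_xi, eta_xi, eta_phi, eta_h),
  (g_phi_r, g_h_r, g_xi_l, g_xi_r), (gDl, gDr, gNl, gNr, gZl, gZr, g0l, g0r),
  (phi0, h0, eta0, @scaler0 A V)).

(** ** The defects of the expected formulas for Dphi and Dh *)

Lemma DphiDl X X' Y : Dphi (X + X') Y = Dphi X Y + Dphi X' Y.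
Proof. by rewrite !DphiE !nablaDl phiD opprD addrACA. Qed.
Lemma DphiZl a X Y : Dphi (a *: X) Y = a *: Dphi X Y.
Proof. by rewrite !DphiE !nablaZl phiZ scalerBr. Qed.
Lemma DphiD X Y Y' : Dphi X (Y + Y') = Dphi X Y + Dphi X Y'.
Proof. by rewrite !DphiE !(nablaD, phiD) opprD addrACA. Qed.
Lemma DphiZ X a Y : Dphi X (a *: Y) = a *: Dphi X Y.
Proof.
rewrite !DphiE !(nablaZ, phiZ, phiD).
by apply: g_inj => W; rewrite !gE; ring.
Qed.
Lemma DhDl X X' Y : Dh (X + X') Y = Dh X Y + Dh X' Y.
Proof. by rewrite !DhE !nablaDl hD opprD addrACA. Qed.
Lemma DhZl a X Y : Dh (a *: X) Y = a *: Dh X Y.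
Proof. by rewrite !DhE !nablaZl hZ scalerBr. Qed.
Lemma DhD X Y Y' : Dh X (Y + Y') = Dh X Y + Dh X Y'.
Proof. by rewrite !DhE !(nablaD, hD) opprD addrACA. Qed.
Lemma DhZ X a Y : Dh X (a *: Y) = a *: Dh X Y.
Proof.
rewrite !DhE !(nablaZ, hZ, hD).
by apply: g_inj => W; rewrite !gE; ring.
Qed.

(** The value of [Dh X xi], that is [- h (nabla X xi)], written in terms of
    [phi] and [h]. *)
Definition Dh_xi_value X := (1 + k) *: phi X - phi (h X).
Local Notation B := Dh_xi_value.

(** Among the bilinear maps with the values of [Dphi] and [Dh] on [xi] and the
    same symmetry with respect to [g], those whose restriction to the kernel of
    [eta] takes values in the multiples of [xi]. *)
Definition phi_model X Y := eta Y *: (X - h X) - g (X - h X) Y *: xi.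
Definition h_model X Y :=
  eta Y *: B X + g (B X) Y *: xi - (m * eta X) *: phi (h Y).

(** The differences between [Dphi], [Dh] and these models vanish when an
    argument is [xi], and satisfy the homogeneous forms of the linear identities
    which link [Dphi] and [Dh]. *)
Definition phi_defect X Y := locked (Dphi X Y - phi_model X Y).
Lemma phi_defectE X Y : phi_defect X Y =
  Dphi X Y - (eta Y *: (X - h X) - g (X - h X) Y *: xi).
Proof. by rewrite /phi_defect -lock. Qed.

Definition h_defect X Y := locked (Dh X Y - h_model X Y).
Lemma h_defectE X Y : h_defect X Y = Dh X Y -
  (eta Y *: ((1 + k) *: phi X - phi (h X)) +
   g ((1 + k) *: phi X - phi (h X)) Y *: xi - (m * eta X) *: phi (h Y)).
Proof. by rewrite /h_defect -lock. Qed.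

Lemma phi_defectDl X X' Y : phi_defect (X + X') Y =
  phi_defect X Y + phi_defect X' Y.
Proof.
by rewrite !phi_defectE DphiDl; apply: g_inj => W; rewrite !tensorE; ring.
Qed.
Lemma phi_defectZl a X Y : phi_defect (a *: X) Y = a *: phi_defect X Y.
Proof.
by rewrite !phi_defectE DphiZl; apply: g_inj => W; rewrite !tensorE; ring.
Qed.
Lemma phi_defectD X Y Y' : phi_defect X (Y + Y') =
  phi_defect X Y + phi_defect X Y'.
Proof.
by rewrite !phi_defectE DphiD; apply: g_inj => W; rewrite !tensorE; ring.
Qed.
Lemma phi_defectZ X a Y : phi_defect X (a *: Y) = a *: phi_defect X Y.
Proof.
by rewrite !phi_defectE DphiZ; apply: g_inj => W; rewrite !tensorE; ring.
Qed.
Lemma h_defectD X Y Y' : h_defect X (Y + Y') = h_defect X Y + h_defect X Y'.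
Proof.
by rewrite !h_defectE DhD; apply: g_inj => W; rewrite !tensorE; ring.
Qed.
Lemma h_defectZ X a Y : h_defect X (a *: Y) = a *: h_defect X Y.
Proof.
by rewrite !h_defectE DhZ; apply: g_inj => W; rewrite !tensorE; ring.
Qed.
Lemma phi_defectN X Y : phi_defect X (- Y) = - phi_defect X Y.
Proof. by rewrite -scaleN1r phi_defectZ scaleN1r. Qed.
Lemma h_defectN X Y : h_defect X (- Y) = - h_defect X Y.
Proof. by rewrite -scaleN1r h_defectZ scaleN1r. Qed.
Lemma phi_defectNl X Y : phi_defect (- X) Y = - phi_defect X Y.
Proof. by rewrite -scaleN1r phi_defectZl scaleN1r. Qed.

Lemma phi_defect_xi X : phi_defect xi X = 0.
Proof.
by rewrite phi_defectE Dphi_xi; apply: g_inj => W; rewrite !tensorE; ring.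
Qed.
Lemma phi_defect_xi_r X : phi_defect X xi = 0.
Proof.
by rewrite phi_defectE Dphi_xi_r S_E; apply: g_inj => W; rewrite !tensorE; ring.
Qed.
Lemma h_defect_xi_r X : h_defect X xi = 0.
Proof.
by rewrite h_defectE Dh_xi_r S_E; apply: g_inj => W; rewrite !tensorE; ring.
Qed.

Lemma g_phi_defect_skew X Y Z : g (phi_defect X Y) Z = - g (phi_defect X Z) Y.
Proof.
apply: eq_from (g_Dphi_skew X Y Z) _.
by rewrite !phi_defectE !tensorE; ring.
Qed.

Lemma phi_defect_closed X Y Z :
  g (phi_defect X Y) Z + g (phi_defect Y Z) X + g (phi_defect Z X) Y = 0.
Proof.
apply: eq_from (Dphi_closed X Y Z) _.
rewrite !phi_defectE !tensorE !(gC Z) !(g_hC Z) (gC Y X) (g_hC Y X).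
by ring.
Qed.

Lemma phi_defect_phi X Y : phi_defect X (phi Y) = - phi (phi_defect X Y).
Proof.
apply: veq_from (Dphi_phi X Y) _ => W.
by rewrite !phi_defectE S_E !tensorE; ring.
Qed.

Lemma g_h_defect_sym X Y Z : g (h_defect X Y) Z = g (h_defect X Z) Y.
Proof.
apply: eq_from (g_Dh_sym X Y Z) _.
by rewrite !h_defectE !tensorE (g_phihC Y) (g_phihC Z Y); ring.
Qed.

Lemma h_defect_phi X Y :
  h_defect X (phi Y) + h (phi_defect X Y) + phi_defect X (h Y)
  + phi (h_defect X Y) = 0.
Proof.
apply: veq_from (Dh_phi X Y) _ => W.
by rewrite !phi_defectE !h_defectE !tensorE; ring.
Qed.

(** Differentiate [h2]. *)
Lemma h_defect_h X Y : h_defect X (h Y) = - h (h_defect X Y).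
Proof.
have e : Dh X (h Y) + h (Dh X Y) =
    - (1 + k) *: ((g (S X) Y) *: xi + eta Y *: S X).
  rewrite (DhE X (h Y)) h2 nablaZ actD act1 actk addr0 scale0r add0r.
  rewrite phi2 nablaD nablaN nablaZ act_eta nabla_h hD h2 phi2.
  by apply: g_inj => W; rewrite !tensorE; ring.
apply: veq_from e _ => W.
by rewrite !h_defectE S_E !tensorE; ring.
Qed.

(** The (k, m)-condition: [curv_xi] expresses the curvature of [xi] by the
    antisymmetrisation of [Dphi] and [Dh]. *)
Lemma defect_codazzi X Y :
  - phi_defect X Y + phi_defect X (h Y) + phi (h_defect X Y) =
  - phi_defect Y X + phi_defect Y (h X) + phi (h_defect Y X).
Proof.
have := kappa_mu X Y; rewrite curv_xi => e; apply: veq_from e _ => W.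
rewrite !phi_defectE !h_defectE !tensorE (gC Y X) (g_phiC Y X) (g_hC Y X)
  (g_phihC Y X).
by ring.
Qed.

Lemma eta_phi_defect X Y : eta (phi_defect X Y) = 0.
Proof. by rewrite -g_xi_r g_phi_defect_skew phi_defect_xi_r g0l oppr0. Qed.
Lemma eta_h_defect X Y : eta (h_defect X Y) = 0.
Proof. by rewrite -g_xi_r g_h_defect_sym h_defect_xi_r g0l. Qed.
Lemma phi_defect_phi2 X Y : phi_defect X (phi (phi Y)) = phi_defect X Y.
Proof.
rewrite phi2 phi_defectD phi_defectN phi_defectZ phi_defect_xi_r.
by rewrite scaler0 subr0.
Qed.
Lemma phi2_phi_defect X Y : phi (phi (phi_defect X Y)) = phi_defect X Y.
Proof. by rewrite phi2 eta_phi_defect scale0r subr0. Qed.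

(** The analogue of the fact that almost Kaehler manifolds are quasi-Kaehler:
    with [t] and [u] the defect evaluated on [X, Y, Z] and [phi X, phi Y, Z],
    closedness gives [u1 + u2 + t3 = 0] along cyclic permutations, and the [ti]
    sum to [0]. *)
Lemma phi_defect_phi_phi X Y : phi_defect (phi X) (phi Y) = phi_defect X Y.
Proof.
apply: g_inj => Z.
have u U W Q : g (phi_defect (phi U) (phi W)) Q +
    g (phi_defect (phi W) (phi Q)) U + g (phi_defect Q U) W = 0.
  rewrite -[RHS](phi_defect_closed (phi U) (phi W) Q); congr (_ + _ + _).
    by rewrite phi_defect_phi gNl -g_phi_r.
  by rewrite phi_defect_phi g_phi_r phiN phi2_phi_defect gNl opprK.
apply/eqP; rewrite -subr_eq0; apply/eqP; apply: (double_inj half2).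
have := eq_sub (eq_add (u Z X Y) (u X Y Z))
  (eq_add (u Y Z X) (phi_defect_closed X Y Z)).
by move/eq_from; apply; ring.
Qed.

Lemma phi_defect_phil X Y : phi_defect (phi X) Y = - phi (phi_defect X Y).
Proof.
by rewrite -(phi_defect_phi2 (phi X)) phi_defect_phi_phi phi_defect_phi.
Qed.

(** Pair the Codazzi equations on [(Y, Z)], [(phi Y, phi Z)], [(Y, phi Z)] and
    [(phi Y, Z)] with [X], [X], [phi X] and [phi X].  Their combination with
    signs [+, +, -, -] contains [h_defect] only through the anticommutators
    controlled by [h_defect_phi].  What is left says that the last two terms of
    the closedness relation on [h X, Y, Z] cancel, so that the first one
    vanishes. *)
Lemma phi_defect_h X Y : phi_defect (h X) Y = 0.
Proof.
apply: g_nondeg => Z; apply: (double_inj half2).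
have pair U W Q e := congr1 (g^~ Q) (e : U = W).
have phi_g U W : eta U = 0 -> g (phi U) (phi W) = - g U W.
  by move=> e; rewrite g_phi_phi e mul0r addr0.
have e1 := pair _ _ X (defect_codazzi Y Z).
have e2 := pair _ _ X (defect_codazzi (phi Y) (phi Z)).
have e3 := pair _ _ (phi X) (defect_codazzi Y (phi Z)).
have e4 := pair _ _ (phi X) (defect_codazzi (phi Y) Z).
have f1 := pair _ _ X (h_defect_phi Y Z).
have f2 := pair _ _ X (h_defect_phi Z Y).
have f3 := pair _ _ X (congr1 phi (h_defect_phi (phi Y) Z)).
have f4 := pair _ _ X (congr1 phi (h_defect_phi (phi Z) Y)).
have c := phi_defect_closed (h X) Y Z.
have := eq_sub (eq_add (eq_add e1 e2) (eq_add f2 f4))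
  (eq_add (eq_add e3 e4) (eq_add f1 f3)).
move=> e; have := eq_add e (eq_add c c); move/eq_from; apply.
rewrite /= !(phiD, phi0, hN, h_phi, phi_defect_phi, phi_defect_phil,
  phi_defectN, phiN, phi2_phi_defect).
rewrite !(phi2 (h _)) !(phi2 (h_defect _ _)).
rewrite !(eta_h_defect, eta_h, scale0r, subr0) !gE.
rewrite !(phi_g, eta_h_defect, eta_phi_defect) // -!(g_h_r (phi_defect _ _)).
rewrite (g_phi_defect_skew Z (h X) Y).
by ring.
Qed.

(** [phi_defect_h] applied twice, since [h] squares to the invertible scalar
    [1 + k] off [xi]. *)
Lemma Dphi_formula X Y : Dphi X Y = phi_model X Y.
Proof.
have t0 : phi_defect X Y = 0.
  apply: g_nondeg => W; apply: (unit_mulI kinvM);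
    rewrite mulr0 -gZl -phi_defectZl.
  have := phi_defect_h (h X) Y;
    rewrite h2 phi2 !(phi_defectZl, phi_defectDl, phi_defectNl) phi_defect_xi.
  by rewrite scaler0 subr0 => ->; rewrite g0l.
by apply: veq_from t0 _ => W; rewrite /phi_defect -lock !gE; ring.
Qed.

(** With [phi_defect = 0], the Codazzi equation makes [g (h_defect X Y) Z]
    totally symmetric, while the sign changes when [h] moves from [Y] to [Z];
    three such moves around the cycle give [h_defect X (h Y) = 0]. *)
Lemma Dh_formula X Y : Dh X Y = h_model X Y.
Proof.
have t0 U W : phi_defect U W = 0.
  by rewrite /phi_defect -lock Dphi_formula subrr.
have hC U W : h_defect U W = h_defect W U.
  have := defect_codazzi U W; rewrite !t0 oppr0 !add0r => /(congr1 phi).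
  by rewrite !phi2 !eta_h_defect !scale0r !subr0.
have move_h U W Z : g (h_defect U (h W)) Z = - g (h_defect U W) (h Z).
  by rewrite h_defect_h gNl g_h_r.
have hh0 U W : h_defect U (h W) = 0.
  apply: g_nondeg => Z; apply: (double_inj half2); rewrite {1}move_h.
  rewrite hC -move_h g_h_defect_sym hC g_h_defect_sym move_h.
  by rewrite g_h_defect_sym hC g_h_defect_sym hC addNr.
have e : h_defect X Y = 0.
  apply: g_nondeg => W; apply: (unit_mulI kinvM); rewrite mulr0 -gZl -h_defectZ.
  have := hh0 X (h Y); rewrite h2 phi2 !(h_defectZ, h_defectD, h_defectN)
    h_defect_xi_r.
  by rewrite scaler0 subr0 => ->; rewrite g0l.
by apply: veq_from e _ => W; rewrite /h_defect -lock !gE; ring.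
Qed.

(** ** Ricci identities *)

(** The covariant derivative in direction [X] of the tensor [phi_model],
    evaluated at [Y, Z]. *)
Definition ricci_phi X Y Z := g (Dh X Y) Z *: xi - g (Y - h Y) Z *: S X
  + g (S X) Z *: (Y - h Y) - eta Z *: Dh X Y.

Lemma curv_phi X Y Z : curv X Y (phi Z) =
  phi (curv X Y Z) + (ricci_phi X Y Z - ricci_phi Y X Z).
Proof.
(* The terms in [Dphi] are symmetric in [U] and [W] up to the bracket, so only
   [ricci_phi] survives in the commutator. *)
have d U W T : nabla U (nabla W (phi T)) = phi (nabla U (nabla W T))
    + Dphi U (nabla W T) + Dphi W (nabla U T) + Dphi (nabla U W) T
    + ricci_phi U W T.
  rewrite nabla_phi nablaD nabla_phi.
  rewrite (Dphi_formula W) /phi_model nablaD nablaN !nablaZ !nablaD !nablaN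
    nabla_h.
  rewrite nabla_g nablaD nablaN nabla_h act_eta !Dphi_formula /phi_model.
  by apply: g_inj => Q; rewrite /ricci_phi !gE; ring.
rewrite !curvE !d nabla_phi -torsion_free DphiDl -(scaleN1r (nabla Y X)) DphiZl.
by apply: g_inj => W; rewrite !(phiD, phiN) !gE; ring.
Qed.

(** The covariant derivative of the endomorphism [Dh_xi_value]. *)
Definition nabla_B X Y :=
  (1 + k) *: Dphi X Y - Dphi X (h Y) - phi (Dh X Y).
(** The covariant derivative in direction [X] of the tensor [h_model],
    evaluated at [Y, Z]. *)
Definition ricci_h X Y Z :=
  g (nabla_B X Y) Z *: xi + g (B Y) Z *: S X
  + g (S X) Z *: B Y + eta Z *: nabla_B X Y
  - (m * g (S X) Y) *: phi (h Z) - (m * eta Y) *: (Dphi X (h Z) + phi (Dh X Z)).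

Lemma curv_h X Y Z : curv X Y (h Z) =
  h (curv X Y Z) + (ricci_h X Y Z - ricci_h Y X Z).
Proof.
have d U W T : nabla U (nabla W (h T)) = h (nabla U (nabla W T))
    + Dh U (nabla W T) + Dh W (nabla U T) + Dh (nabla U W) T
    + ricci_h U W T.
  rewrite nabla_h nablaD nabla_h.
  rewrite (Dh_formula W) /h_model /Dh_xi_value !(nablaD, nablaN, nablaZ)
    !(nabla_phi, nabla_h).
  rewrite !(actD, actM, act1, actk, actm).
  rewrite nabla_g !(nablaD, nablaN, nablaZ) !(nabla_phi, nabla_h).
  rewrite !(actD, act1, actk) !act_eta /ricci_h /nabla_B !Dh_formula /h_model
    /Dh_xi_value.
  by apply: g_inj => Q; rewrite !tensorE; ring.
rewrite !curvE !d nabla_h -torsion_free DhDl -(scaleN1r (nabla Y X)) DhZl.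
by apply: g_inj => W; rewrite !(hD, hN) !gE; ring.
Qed.

(** ** The curvature tensor *)

Definition kappa_mu_tensor X Y Z W :=
  (-1 + half * m) * (g Y Z * g X W - g X Z * g Y W)
  + g Y Z * g (h X) W - g X Z * g (h Y) W
  - g Y W * g (h X) Z + g X W * g (h Y) Z
  + (-1 + half * m) * kinv * (g (h Y) Z * g (h X) W - g (h X) Z * g (h Y) W)
  - half * m * (g (phi Y) Z * g (phi X) W - g (phi X) Z * g (phi Y) W)
  + (- k - half * m) * kinv * (g (phi (h Y)) Z * g (phi (h X)) W
                               - g (phi (h Y)) W * g (phi (h X)) Z)
  + m * (g (phi X) Y * g (phi Z) W)
  + eta X * eta W * ((k + 1 - half * m) * g Y Z + (m - 1) * g (h Y) Z)
  - eta X * eta Z * ((k + 1 - half * m) * g Y W + (m - 1) * g (h Y) W)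
  + eta Y * eta Z * ((k + 1 - half * m) * g X W + (m - 1) * g (h X) W)
  - eta Y * eta W * ((k + 1 - half * m) * g X Z + (m - 1) * g (h X) Z).

Definition curv_defect X Y Z W :=
  locked (g (curv X Y Z) W - kappa_mu_tensor X Y Z W).
Lemma curv_defectE X Y Z W : curv_defect X Y Z W =
  g (curv X Y Z) W - kappa_mu_tensor X Y Z W.
Proof. by rewrite /curv_defect -lock. Qed.

(** Makes [m / 2] and [m] polynomials in one variable for the ring tactic. *)
Lemma half_m : {b | half * m = b & m = b + b}.
Proof. by exists (half * m); rewrite // -mulrDl half2 mul1r. Qed.
Lemma kinvE : kinv * k = 1 - kinv.
Proof. by rewrite -kinvM mulrDr mulr1 addrC addKr. Qed.

Lemma curv_defect_antisym X Y Z W : curv_defect Y X Z W = - curv_defect X Y Z W.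
Proof.
rewrite !curv_defectE curv_antisym /kappa_mu_tensor gNl (g_phiC Y X).
by ring.
Qed.
Lemma curv_defect_skew X Y Z W : curv_defect X Y W Z = - curv_defect X Y Z W.
Proof.
by rewrite !curv_defectE g_curv_skew /kappa_mu_tensor (g_phiC W Z); ring.
Qed.
Lemma curv_defect_bianchi X Y Z W : curv_defect X Y Z W + curv_defect Y Z X W +
  curv_defect Z X Y W = 0.
Proof.
have e := congr1 (g^~ W) (bianchi X Y Z); apply: eq_from e _.
rewrite !curv_defectE /kappa_mu_tensor /= !gE ?(gC Z X) ?(gC Z Y) ?(g_hC Z X)
  ?(g_hC Z Y) ?(g_phiC Z Y) ?(g_phiC Z X).
rewrite ?(gC Y X) ?(g_hC Y X) ?(g_phiC Y X) ?(g_phihC Y X) ?(g_phihC Z X)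
  ?(g_phihC Z Y).
have [b -> ->] := half_m.
by ring.
Qed.
Lemma curv_defectD X Y Z W W' : curv_defect X Y Z (W + W') =
  curv_defect X Y Z W + curv_defect X Y Z W'.
Proof. by rewrite !curv_defectE /kappa_mu_tensor !tensorE; ring. Qed.
Lemma curv_defectZ X Y Z a W : curv_defect X Y Z (a *: W) =
  a * curv_defect X Y Z W.
Proof. by rewrite !curv_defectE /kappa_mu_tensor !tensorE; ring. Qed.
Lemma curv_defect_xi X Y Z : curv_defect X Y Z xi = 0.
Proof.
rewrite curv_defect_skew curv_defectE kappa_mu /kappa_mu_tensor !tensorE.
have [b -> ->] := half_m.
by ring.
Qed.
Lemma curv_defect_phi X Y Z W : curv_defect X Y (phi Z) W =
  - curv_defect X Y Z (phi W).
Proof.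
rewrite !curv_defectE curv_phi /ricci_phi !Dh_formula /h_model /Dh_xi_value
  !S_E /kappa_mu_tensor !tensorE.
rewrite ?(gC Y X) ?(g_phiC Y X) ?(g_hC Y X) ?(g_phihC Y X).
have [b -> ->] := half_m.
by ring: kinvE.
Qed.
Lemma curv_defect_h X Y Z W : curv_defect X Y (h Z) W = curv_defect X Y Z (h W).
Proof.
rewrite !curv_defectE curv_h /ricci_h /nabla_B !Dphi_formula !Dh_formula
  /phi_model /h_model /Dh_xi_value !S_E /kappa_mu_tensor !tensorE.
rewrite ?(gC Y X) ?(g_phiC Y X) ?(g_hC Y X) ?(g_phihC Y X).
have [b -> ->] := half_m.
by ring: kinvE.
Qed.

Theorem curvature_formula X Y Z W : g (curv X Y Z) W = kappa_mu_tensor X Y Z W.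
Proof.
apply/eqP; rewrite -subr_eq0 -curv_defectE; apply/eqP.
have curv_defectN P Q R U : curv_defect P Q R (- U) = - curv_defect P Q R U.
  by rewrite -scaleN1r curv_defectZ mulN1r.
have phi2W P Q R U : curv_defect P Q R (phi (phi U)) = curv_defect P Q R U.
  by rewrite phi2 curv_defectD curv_defectN curv_defectZ curv_defect_xi mulr0
    subr0.
apply: (D_eq0 half2 kinvM curv_defect_antisym curv_defect_skew
  curv_defect_bianchi curv_defect_h curv_defect_phi) => //.
- by move=> P Q R U; rewrite h_phi curv_defectN.
- by move=> P Q R U; rewrite h2 curv_defectZ phi2W.
Qed.
End Paracontact.

(** * Vector fields on a smooth manifold *)

Section VectorFieldAlgebra.
Context {R : realType} {d : nat} {M : smoothManifold R d}.
Implicit Types (f u v : 'C^oo(M)) (X Y Z : 'X(M)) (p : M).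

Lemma smoothFunP f u : (forall p, f p = u p) -> f = u.
Proof. by move=> e; apply/val_inj/funext. Qed.

Lemma vectorFieldP X Y : (forall f, X f = Y f) -> X = Y.
Proof. by move=> e; apply/val_inj/funext. Qed.

Lemma vf_D X f u : X (f + u) = X f + X u.
Proof. by have [-> _ _] := asboolP _ (vf_valP X). Qed.
Lemma vf_M X f u : X (f * u) = f * X u + u * X f.
Proof. by have [_ _ ->] := asboolP _ (vf_valP X). Qed.
Lemma vf_const X (c : R) : X c%:S = 0.
Proof.
have [_ XZ XM] := asboolP _ (vf_valP X).
have X1 : X 1 = 0.
  have := XM 1 1; rewrite !mul1r => /eqP.
  by rewrite -subr_eq0 opprD addNKr oppr_eq0 => /eqP.
by rewrite -[c%:S]mulr1 XZ X1 mulr0.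
Qed.
Lemma vf_addE X Y f : (X + Y) f = X f + Y f.
Proof. by []. Qed.
Lemma vf_B X f u : X (f - u) = X f - X u.
Proof.
have X0 : X 0 = 0 by apply: (addrI (X 0)); rewrite -vf_D !addr0.
rewrite vf_D; congr (_ + _); apply/eqP.
by rewrite -addr_eq0 -vf_D addNr X0.
Qed.

Lemma value_eq0 X : (forall p, value p X = 0) -> X = 0.
Proof.
move=> X0; apply: vectorFieldP => f; apply: smoothFunP => p.
by have := congr1 (fun v : tangent p => v f) (X0 p).
Qed.

Lemma bracket_jacobi X Y Z :
  [[X, [[Y, Z]]]] + [[Y, [[Z, X]]]] + [[Z, [[X, Y]]]] = 0.
Proof.
apply: vectorFieldP => f; rewrite !vf_addE /= !vf_B.
transitivity (0 : 'C^oo(M)); last by [].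
by ring.
Qed.

Lemma metric_nondeg (g : pseudoRiemannianMetric M) X :
  (forall Y, g X Y = 0) -> X = 0.
Proof.
move=> gX0; apply: value_eq0 => p.
by apply: (@metric_nondegenerate R d M g p X) => Y; rewrite gX0.
Qed.

Lemma half_double : (2^-1 : R)%:S + (2^-1)%:S = 1 :> 'C^oo(M).
Proof. by apply: smoothFunP => p /=; rewrite [RHS](splitr 1) div1r. Qed.

Lemma kappa_mu_curvature (n : nat)
    (phi : {linear 'X(M) -> 'X(M)}) (xi : 'X(M)) (eta : {scalar 'X(M)})
    (g : pseudoRiemannianMetric M) (nabla : 'X(M) -> 'X(M) -> 'X(M))
    (kappa mu : R) :
  is_paracontact_metric n phi xi eta g ->
  is_levi_civita g nabla ->
  kappa_mu_condition phi xi eta nabla kappa mu ->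
  -1 < kappa ->
  forall X Y Z W,
  g (curvature nabla X Y Z) W =
  kappa_mu_tensor (2^-1)%:S ((kappa + 1)^-1)%:S kappa%:S mu%:S
    (metric_form g) phi (htensor phi xi) eta X Y Z W.
Proof.
move=> [ [eta1 phi2 _ _] compat contact] [ [nL nA nLeib] tor met] kmu k1.
move=> X Y Z W.
have curvE U V T : curv bracket nabla U V T = curvature nabla U V T.
  by rewrite /curv -lock.
have nDl U U' T : nabla (U + U') T = nabla U T + nabla U' T.
  by have := nL 1 U U' T; rewrite !scale1r.
have n0 T : nabla 0 T = 0.
  by apply: (addrI (nabla 0 T)); rewrite -nDl !addr0.
have k0 : kappa + 1 != 0 by rewrite gt_eqF // -ltrBlDr sub0r.
rewrite -curvE.
apply: (@curvature_formula 'C^oo(M) 'X(M) (2^-1)%:S ((kappa + 1)^-1)%:S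
  kappa%:S mu%:S (fun U f => U f : 'C^oo(M)) bracket nabla (metric_form g)
  phi (htensor phi xi) xi eta) => //.
- exact: half_double.
- apply: smoothFunP => p.
  by change ((kappa + 1)^-1 * (1 + kappa) = 1); rewrite [1 + _]addrC mulVf.
- by move=> U; split; exact: vf_const.
- exact: vf_D.
- exact: vf_M.
- exact: bracket_jacobi.
- by move=> a U T; have := nL a U 0 T; rewrite !addr0 n0 addr0.
- exact: Defs.metric_sym.
- by move=> U T T'; rewrite linearD.
- by move=> a U T; rewrite linearZ.
- by move=> U; exact: metric_nondeg.
- by move=> U T; rewrite linearD.
- by move=> a U; rewrite linearZ.
- by move=> U T; rewrite linearD.
- by move=> a U; rewrite linearZ.
- by move=> U T; rewrite curvE kmu.
Qed.
End VectorFieldAlgebra.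

Theorem corollary4p12 (R : realType) (n : nat) (M : smoothManifold R (2 * n)%N)
    (phi : {linear 'X(M) -> 'X(M)}) (xi : 'X(M)) (eta : {scalar 'X(M)})
    (g : pseudoRiemannianMetric M) (nabla : 'X(M) -> 'X(M) -> 'X(M))
    (kappa mu : R) :
  let h := htensor phi xi in
  is_paracontact_metric n phi xi eta g ->
  is_levi_civita g nabla ->
  kappa_mu_condition phi xi eta nabla kappa mu ->
  -1 < kappa ->
  constant_index (metric_form g) (eigen_dist h (Num.sqrt (1 + kappa))) ->
  constant_index (metric_form g) (eigen_dist h (- Num.sqrt (1 + kappa))) ->
  forall (X Y Z W : 'X(M)) (p : M),
  g (curvature nabla X Y Z) W p =
    (-1 + mu / 2) * (g Y Z p * g X W p - g X Z p * g Y W p)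
    + g Y Z p * g (h X) W p - g X Z p * g (h Y) W p
    - g Y W p * g (h X) Z p + g X W p * g (h Y) Z p
    + (-1 + mu / 2) / (kappa + 1)
      * (g (h Y) Z p * g (h X) W p - g (h X) Z p * g (h Y) W p)
    - mu / 2
      * (g (phi Y) Z p * g (phi X) W p - g (phi X) Z p * g (phi Y) W p)
    + (- kappa - mu / 2) / (kappa + 1)
      * (g (phi (h Y)) Z p * g (phi (h X)) W p
         - g (phi (h Y)) W p * g (phi (h X)) Z p)
    + mu * (g (phi X) Y p * g (phi Z) W p)
    + eta X p * eta W p
      * ((kappa + 1 - mu / 2) * g Y Z p + (mu - 1) * g (h Y) Z p)
    - eta X p * eta Z p
      * ((kappa + 1 - mu / 2) * g Y W p + (mu - 1) * g (h Y) W p)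
    + eta Y p * eta Z p
      * ((kappa + 1 - mu / 2) * g X W p + (mu - 1) * g (h X) W p)
    - eta Y p * eta W p
      * ((kappa + 1 - mu / 2) * g X Z p + (mu - 1) * g (h X) Z p).
Proof.
move=> h pcm lc kmu k1 _ _ X Y Z W p.
have := congr1 (fun f : 'C^oo(M) => f p)
  (kappa_mu_curvature pcm lc kmu k1 X Y Z W).
rewrite /kappa_mu_tensor => -> /=; rewrite !fctE /cst -/h.
have -> : (1 : M -> R) p = 1 by [].
by ring.
Qed.
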